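(* Let $G=Q_8\times A$, where $A$ is a finite abelian group, and let $S$ be an inverse-closed multiset of elements of $G$. For $q\in Q_8$ let $B_q$ be the multiset of elements of $A$ in which each $a\in A$ has multiplicity $\mu_S((q,a))$. Then $\mathrm{Cay}(G,S)$ is integral (all eigenvalues of its adjacency matrix are integers) if and only if the following three conditions hold: (i) $B_1,B_{-1}\in\mathcal{C}(A)$; (ii) the multiset union $B_q\cup B_{-q}$ (multiplicities are added) belongs to $\mathcal{C}(A)$ for every $q\in Q_8\setminus\{1,-1\}$; (iii) for every $\lambda\in\mathrm{Irr}(A)$, the number $\widehat{\lambda}(B_i)^2+\widehat{\lambda}(B_j)^2+\widehat{\lambda}(B_k)^2$ is a negative square of an integer, i.e., equals $-m^2$ for some integer $m$ (with $m=0$ allowed).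
   Context: $Q_8=\{\pm1,\pm i,\pm j,\pm k\}$ is the quaternion group, with $i^2=j^2=k^2=ijk=-1$. A multiset $S$ of elements of a finite group $G$ is given by its multiplicity function $\mu_S:G\to\mathbb{Z}_{\ge 0}$; it is inverse-closed if $\mu_S(s)=\mu_S(s^{-1})$ for all $s$. For an inverse-closed multiset $S$, the Cayley multigraph $\mathrm{Cay}(G,S)$ has vertex set $G$, and the number of edges joining $x$ and $y$ is $\mu_S(xy^{-1})$; its adjacency matrix is the $G\times G$ matrix with $(x,y)$ entry $\mu_S(xy^{-1})$. For a finite group $H$, $\mathcal{B}(H)$ denotes the boolean algebra of subsets of $H$ generated by the normal subgroups of $H$ (under unions, intersections and symmetric differences), and the integral cone $\mathcal{C}(H)$ is the collection of all multisets whose multiplicity function is a non-negative integer combination of the indicator functions of atoms (minimal nonempty members) of $\mathcal{B}(H)$. $\mathrm{Irr}(A)$ is the set of irreducible complex characters of $A$, i.e., homomorphisms $\lambda:A\to\mathbb{C}^\times$. For a multiset $D$ of elements of $A$, $\lambda(D)=\sum_{g\in A}\mu_D(g)\lambda(g)$, and $\widehat{\lambda}(D)=\lambda(D)-\lambda(D^{-1})=\sum_{g\in A}\mu_D(g)\bigl(\lambda(g)-\lambda(g^{-1})\bigr)$. *)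

(* Defs.v *)
From HB Require Import structures.
From mathcomp Require Import all_boot all_order all_fingroup all_algebra.
From mathcomp Require Import all_solvable all_field all_character.

Set Implicit Arguments.
Unset Strict Implicit.
Unset Printing Implicit Defensive.

Import GroupScope GRing.Theory.

(* The inductive clauses also give complements and the empty set: the whole
   group is normal in itself, and set0 is the symmetric difference of any set
   with itself. *)
Inductive normal_algebra (gT : finGroupType) : {set gT} -> Prop :=
| NormalAlgebraGroup (N : {group gT}) of N <| [set: gT] : normal_algebra N
| NormalAlgebraU (B C : {set gT}) of normal_algebra B & normal_algebra C :
    normal_algebra (B :|: C)
| NormalAlgebraI (B C : {set gT}) of normal_algebra B & normal_algebra C :
    normal_algebra (B :&: C)
| NormalAlgebraSymD (B C : {set gT}) of normal_algebra B & normal_algebra C :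
    normal_algebra ((B :\: C) :|: (C :\: B)).

Definition normal_atom (gT : finGroupType) (B : {set gT}) : Prop :=
  [/\ normal_algebra B, B != set0 &
      forall C, normal_algebra C -> C != set0 -> C \subset B -> C = B].

(* A multiset of elements of gT is represented by its multiplicity function
   D : {ffun gT -> nat}. *)
Definition integral_cone (gT : finGroupType) (D : {ffun gT -> nat}) : Prop :=
  exists c : {set gT} -> nat,
    (forall B, c B != 0%N -> normal_atom B) /\
    (forall x, D x = (\sum_(B : {set gT}) c B * (x \in B))%N).

Section Multisets.

Variable gT : finGroupType.
Implicit Types D E : {ffun gT -> nat}.

Definition inverse_closed D : Prop := forall s, D s = D s^-1%g.

Definition multiset_union D E : {ffun gT -> nat} := [ffun x => (D x + E x)%N].

Definition multiset_inv D : {ffun gT -> nat} := [ffun x => D x^-1%g].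

Definition cayley_edges D (x y : gT) : nat := D (x * y^-1)%g.

(* Matrices are indexed by ordinals: the vertex set is listed by enum_val. *)
Definition cayley_adjacency D : 'M[algC]_#|gT| :=
  (\matrix_(i, j) (cayley_edges D (enum_val i) (enum_val j))%:R)%R.

Definition cayley_integral D : Prop :=
  forall a : algC, eigenvalue (cayley_adjacency D) a -> a \in Num.int.

Definition char_sum (lambda : 'CF([set: gT])) D : algC :=
  (\sum_g (D g)%:R * lambda g)%R.

Definition char_hat (lambda : 'CF([set: gT])) D : algC :=
  (char_sum lambda D - char_sum lambda (multiset_inv D))%R.

End Multisets.

Definition fiber (qT aT : finGroupType) (S : {ffun qT * aT -> nat}) (q : qT) :
  {ffun aT -> nat} := [ffun a => S (q, a)].

(* The library group 'Q_8 has no named elements, so i, j, k and m1 (standing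
   for -1) are characterised by i^2 = j^2 = k^2 = ijk = -1 with -1 != 1. The two
   lemmas below show that such elements exist and that they always satisfy
   Q_8 = {1, -1, i, -i, j, -j, k, -k}. *)
Definition quaternion_units (m1 i j k : gsort 'Q_8) : Prop :=
  m1 != 1%g /\
  [/\ (i ^+ 2 = m1)%g, (j ^+ 2 = m1)%g, (k ^+ 2 = m1)%g & (i * j * k = m1)%g].

Lemma quaternion_units_exist :
  exists m1 i j k : gsort 'Q_8, quaternion_units m1 i j k.
Proof.
have [[x y] genxy [oy y2 xy]] :=
  @generators_quaternion _ 'Q_8%G 3 isT (isog_refl _).
exists (y ^+ 2)%g, x, y, (y^-1 * x)%g; split.
  by apply/eqP=> /eqP; rewrite -order_dvdn oy.
have e1 : (y^-1 * x = x^-1 * y^-1)%g by rewrite -xy conjgE !mulgA mulgK.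
split=> //; last by rewrite -mulgA mulKVg y2.
rewrite expgS expg1 {1}e1.
have -> : (x^-1 * y^-1 * (y^-1 * x) = (y ^+ 2)^-1 ^ x)%g.
  by rewrite conjgE expgS expg1 invMg !mulgA.
have y4 : (y ^+ 2 * y ^+ 2 = 1)%g.
  by rewrite -expgD; apply/eqP; rewrite -order_dvdn oy.
have -> : ((y ^+ 2)^-1 = y ^+ 2)%g by apply/eqP; rewrite eq_invg_mul y4.
by rewrite {1}y2 conjXg conjgE mulKg -y2.
Qed.

Lemma quaternion_units_enum (m1 i j k : gsort 'Q_8) :
  quaternion_units m1 i j k ->
  let s := [:: 1; m1; i; m1 * i; j; m1 * j; k; m1 * k]%g in
  uniq s /\ s =i [set: gsort 'Q_8].
Proof.
move=> [m1n1 [i2 j2 k2 ijk]] s.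
have kE : k = (i * j)%g.
  by apply: (mulIg k); rewrite ijk -k2 expgS expg1.
have ii : (i * i = m1)%g by rewrite -i2 expgS expg1.
have jj : (j * j = m1)%g by rewrite -j2 expgS expg1.
have kk : (k * k = m1)%g by rewrite -k2 expgS expg1.
have jij : (j * i * j = i)%g.
  by apply: (mulgI i); rewrite ii -kk kE !mulgA.
have cj : (m1 * j = j * m1)%g by rewrite -jj mulgA.
have ci : (i * m1 = m1 * i)%g by rewrite -ii mulgA.
have mm : (m1 * m1 = 1)%g.
  have : ((j * i * j) * (j * i * j) = j * (i * (j * j) * i) * j)%g.
    by rewrite !mulgA.
  rewrite jij jj ci -(mulgA m1 i) ii mulgA -cj -(mulgA m1 j) -cj mulgA.
  by rewrite -(mulgA _ j) jj => e; apply: (mulIg m1); rewrite mul1g -e.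
have mA x y : (m1 * x == y) = (x == m1 * y)%g.
  by rewrite -(inj_eq (mulgI m1)) mulgA mm mul1g.
have mI x y : ((m1 * x == m1 * y) = (x == y))%g by rewrite (inj_eq (mulgI m1)).
have nu u : (u * u = m1)%g -> (u != 1) && (u != m1)%g.
  move=> uu; apply/andP; split; apply/eqP=> e; move: uu; rewrite e => uu.
    by rewrite -uu mulg1 eqxx in m1n1.
  by rewrite -uu mm eqxx in m1n1.
have [[/andP[i1 im] /andP[j1 jm]] /andP[k1 km]] := (nu i ii, nu j jj, nu k kk).
have ij : i != j by apply: contra km => /eqP e; rewrite kE -e ii.
have imj : (i != m1 * j)%g.
  by apply: contra k1 => /eqP e; rewrite kE e -mulgA jj mm.
have ik : i != k.
  by apply: contra j1; rewrite kE -{1}[i]mulg1 (inj_eq (mulgI i)) eq_sym.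
have imk : (i != m1 * k)%g.
  by rewrite -mA; apply: contra jm; rewrite kE -ci (inj_eq (mulgI i)) eq_sym.
have jk : j != k.
  by apply: contra i1; rewrite kE -{1}[j]mul1g (inj_eq (mulIg j)) eq_sym.
have jmk : (j != m1 * k)%g.
  by rewrite -mA kE (inj_eq (mulIg j)) eq_sym.
have us : uniq s.
  rewrite /s /= !inE !negb_or !mI.
  have e1 x : (1 == x)%g = (x == 1)%g by rewrite eq_sym.
  have em x : (m1 == x)%g = (x == m1)%g by rewrite eq_sym.
  rewrite !em !e1 !mA !mulg1 !mm.
  rewrite m1n1 i1 im j1 jm k1 km ij imj ik imk jk jmk.
  have pm u : (u != 1)%g -> (u != m1 * u)%g.
    by move=> _; rewrite -{1}[u]mul1g (inj_eq (mulIg u)) eq_sym.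
  by rewrite !pm.
split=> //; apply/subset_cardP; last by apply/subsetP=> x; rewrite inE.
by rewrite (card_uniqP us) (@card_quaternion 3).
Qed.

(* Main.v *)
Require Import Defs.
From HB Require Import structures.
From mathcomp Require Import all_boot all_order all_fingroup all_algebra.
From mathcomp Require Import all_solvable all_field all_character.
From mathcomp Require Import ring.

(** The regular representation of G = Q_8 x A splits over the pairs (rho,
    lambda) of an irreducible representation rho of Q_8 and a character lambda
    of A, so the eigenvalues of Cay(G, S) are those of the matrices
      sum_q lambda(B_q) rho(q).

    The four linear characters rho, determined by the signs rho(i) and rho(j),
    give the numbers s_1 +- s_i +- s_j +- s_k, the last sign being the product
    of the other two, where s_q = lambda(B_q) + lambda(B_{-q}). The spin
    representation, of degree 2, gives the roots x of
      (x - d_1)^2 = - (d_i^2 + d_j^2 + d_k^2)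
    where d_q = lambda(B_q) - lambda(B_{-q}); since S is inverse-closed,
    B_{-q} is the inverse of B_q when q is i, j or k, so that d_q is then the
    number written with a hat. This is [cayley_integral_quaternion].

    All these numbers are algebraic integers, hence integers as soon as they
    are rational. Four times each s_q is a signed sum of linear eigenvalues,
    while the spin eigenvalues d_1 + r and d_1 - r have sum 2 d_1 and r^2 is
    the opposite of the sum of squares. Therefore the spectrum is integral
    exactly when lambda(B_1), lambda(B_{-1}), s_i, s_j, s_k and r are integers
    for all lambda.

    It remains to see that a multiset D on A lies in the integral cone if and
    only if lambda(D) is an integer for all lambda ([integral_cone_char_sum]).
    The atoms of the boolean algebra are the sets of generators of the cyclic
    subgroups, so the cone consists of the D that take the same value on any
    two generators of a cyclic subgroup. For such a D, lambda(D) is a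
    combination of sums of lambda over the generators of a cyclic group, which
    are integers by induction on its order. Conversely, if y = x^k generates
    the same subgroup as x, a field automorphism raising the roots of unity of
    order #[x] to the power k fixes the integers lambda(D) and sends the Fourier
    inversion formula for D(x) to the one for D(y). *)

Set Implicit Arguments.
Unset Strict Implicit.
Unset Printing Implicit Defensive.

Import GroupScope Order.TTheory GRing.Theory Num.Theory.

(** * The integral cone of an abelian group *)

Section CyclicGenerators.

Variable gT : finGroupType.
Implicit Types (x y : gT) (B C : {set gT}).

Definition cyclic_generators x : {set gT} := [set y | generator <[x]> y].

Lemma cyclic_generatorsE x y : (y \in cyclic_generators x) = (<[x]> == <[y]>).
Proof. by rewrite inE. Qed.

(** On an abelian group these are the functions constant on the atoms. *)
Definition generator_invariant (T : Type) (f : gT -> T) : Prop :=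
  forall x y, <[x]> = <[y]> -> f x = f y.

Lemma normal_algebra0 : @normal_algebra gT set0.
Proof.
have algT := NormalAlgebraGroup (normal_refl [set: gT]%G).
by have := NormalAlgebraSymD algT algT; rewrite setDv setU0.
Qed.

Lemma normal_algebra_bigcup (I : finType) (P : pred I) (F : I -> {set gT}) :
  (forall t, P t -> normal_algebra (F t)) ->
  normal_algebra (\bigcup_(t | P t) F t).
Proof.
move=> algF; elim/big_rec: _ => [|t B Pt algB]; first exact: normal_algebra0.
by apply: NormalAlgebraU => //; apply: algF.
Qed.

Lemma normal_algebraD B C :
  normal_algebra B -> normal_algebra C -> normal_algebra (B :\: C).
Proof.
move=> algB algC.
have -> : B :\: C = B :&: ((B :\: C) :|: (C :\: B)).
  by apply/setP=> x; rewrite !inE; case: (x \in B); case: (x \in C).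
by apply: NormalAlgebraI => //; apply: NormalAlgebraSymD.
Qed.

(** A subgroup contains x exactly when it contains the cycle of x, and boolean
    operations preserve this kind of invariance. *)
Lemma normal_algebra_invariant B :
  normal_algebra B -> generator_invariant (fun x => x \in B).
Proof.
elim=> {B} [N _|B C _ IHB _ IHC|B C _ IHB _ IHC|B C _ IHB _ IHC] x y xy.
- by rewrite -!cycle_subG xy.
- by rewrite !inE (IHB x y xy) (IHC x y xy).
- by rewrite !inE (IHB x y xy) (IHC x y xy).
- by rewrite !inE (IHB x y xy) (IHC x y xy).
Qed.

Hypothesis abelG : abelian [set: gT].

Lemma cycle_normal_algebra x : normal_algebra <[x]>.
Proof. by apply: NormalAlgebraGroup; rewrite -sub_abelian_normal ?subsetT. Qed.

(** The generators are what remains of a cyclic group after removing its proper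
    cyclic subgroups. *)
Lemma cyclic_generators_algebra x : normal_algebra (cyclic_generators x).
Proof.
have -> : cyclic_generators x =
          <[x]> :\: \bigcup_(y | <[y]> \proper <[x]>) <[y]>.
  apply/setP=> y; rewrite cyclic_generatorsE inE; apply/eqP/andP.
    move=> xy; rewrite xy cycle_id; split=> //.
    apply/bigcupP=> -[z zx]; rewrite -cycle_subG => /(proper_sub_trans zx).
    by rewrite properxx.
  case=> noty yx; apply/eqP; rewrite eq_sym eqEproper cycle_subG yx /=.
  by apply: contra noty => yltx; apply/bigcupP; exists y => //; apply: cycle_id.
apply: normal_algebraD; first exact: cycle_normal_algebra.
by apply: normal_algebra_bigcup => y _; apply: cycle_normal_algebra.
Qed.

(** The sets of generators belong to the algebra, and no member of the algebra
    separates two of their points. *)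
Lemma normal_atomP B :
  normal_atom B <-> exists x, B = cyclic_generators x.
Proof.
have sub C x : normal_algebra C -> x \in C -> cyclic_generators x \subset C.
  move=> algC Cx; apply/subsetP=> y; rewrite cyclic_generatorsE => /eqP xy.
  by rewrite -(normal_algebra_invariant algC xy).
have self x : x \in cyclic_generators x by rewrite cyclic_generatorsE.
split=> [[algB /set0Pn[x Bx] minB] | [x ->]].
  exists x; rewrite (minB (cyclic_generators x)) ?sub //.
    exact: cyclic_generators_algebra.
  by apply/set0Pn; exists x.
split; first exact: cyclic_generators_algebra.
  by apply/set0Pn; exists x.
move=> C algC /set0Pn[y Cy] sCx; apply/eqP; rewrite eqEsubset sCx /=.
have := subsetP sCx y Cy; rewrite cyclic_generatorsE => /eqP xy.
by apply: sub; rewrite // (normal_algebra_invariant algC xy).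
Qed.

Lemma integral_cone_invariant (D : {ffun gT -> nat}) :
  integral_cone D <-> generator_invariant D.
Proof.
split=> [[c [atom_c Dc]] x y xy | invD].
  rewrite !Dc; apply: eq_bigr => B _.
  have [-> // | /atom_c[algB _ _]] := eqVneq (c B) 0%N.
  by rewrite (normal_algebra_invariant algB xy).
(* The coefficient of an atom is the common value of D on it. *)
pose c (B : {set gT}) :=
  if [pick x | B == cyclic_generators x] is Some x then D x else 0%N.
exists c; split=> [B | x].
  rewrite /c; case: pickP => // x /eqP-> _.
  by apply/normal_atomP; exists x.
rewrite (bigD1 (cyclic_generators x)) //= big1 => [|B neqB].
  rewrite addn0 cyclic_generatorsE eqxx muln1 /c.
  case: pickP => [y /eqP/setP/(_ x) | /(_ x)]; last by rewrite eqxx.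
  by rewrite !cyclic_generatorsE eqxx => /esym/eqP/invD.
rewrite /c; case: pickP => // y /eqP defB.
suff /negPf-> : x \notin B by rewrite muln0.
apply: contra neqB; rewrite {}defB cyclic_generatorsE => /eqP yx.
by apply/eqP/setP=> z; rewrite !cyclic_generatorsE yx.
Qed.

End CyclicGenerators.

Local Open Scope ring_scope.

(** * Character sums and the integral cone *)

Section CharacterSums.

Variable gT : finGroupType.
Local Notation G := [set: gT].

(** The sum is the order of the cycle times the multiplicity of the trivial
    character in the restriction of xi. *)
Lemma char_sum_cycle (xi : 'CF(G)) (x : gT) :
  xi \is a character -> \sum_(y in <[x]>) xi y \in Num.int.
Proof.
move=> char_xi; have sxG : <[x]> \subset G by apply: subsetT.
have -> : \sum_(y in <[x]>) xi y = #|<[x]>|%:R * '['Res[<[x]>] xi, 1].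
  rewrite cfdotE mulrA divff ?mul1r ?neq0CG //.
  by apply: eq_bigr => y xy; rewrite cfResE // cfun1E xy rmorph1 mulr1.
by rewrite rpredM // intr_nat // Cnat_cfdot_char ?cfRes_char ?cfun1_char.
Qed.

(** By induction on the order: removing from the sum over the cycle the sums
    over the generators of its proper subgroups leaves this sum. *)
Lemma char_sum_generators (xi : 'CF(G)) (x : gT) :
  xi \is a character -> \sum_(y | <[y]>%g == <[x]>%g) xi y \in Num.int.
Proof.
move=> char_xi; have [n] := ubnP #[x]; elim: n x => // n IHn x ltxn.
have := char_sum_cycle x char_xi.
rewrite (bigID (fun y => <[y]>%g == <[x]>%g)) /=.
rewrite (eq_bigl (fun y => <[y]>%g == <[x]>%g)) => [|y]; last first.
  by apply: andb_idl => /eqP <-; apply: cycle_id.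
rewrite addrC rpredDl //.
rewrite (partition_big (fun y => <[y]>%g) (fun C => C \proper <[x]>%g)) /=;
  last first.
  by move=> y /andP[xy neq]; rewrite properEneq neq cycle_subG.
apply: rpred_sum => C ltCx.
have [[z /eqP defC]|noC] := altP (@existsP _ (fun z => <[z]>%g == C)).
  rewrite -defC in ltCx *.
  rewrite (eq_bigl (fun y => <[y]>%g == <[z]>%g)) => [|y]; last first.
    apply: andb_idl => /eqP yz; rewrite -cycle_subG yz.
    by rewrite (proper_sub ltCx) (proper_neq ltCx).
  apply: IHn; apply: leq_trans (proper_card ltCx) _.
  by rewrite -ltnS.
rewrite big_pred0 ?rpred0 // => y; apply/negP=> /andP[_ yC].
by case/existsP: noC; exists y.
Qed.

Lemma char_sum_int (xi : 'CF(G)) (D : {ffun gT -> nat}) :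
  xi \is a character -> generator_invariant D -> char_sum xi D \in Num.int.
Proof.
move=> char_xi invD; rewrite /char_sum.
rewrite (partition_big (fun y => <[y]>%g) predT) //=.
apply: rpred_sum => C _.
have [[z /eqP defC]|noC] := altP (@existsP _ (fun z => <[z]>%g == C)).
  rewrite -defC (eq_bigr (fun y => (D z)%:R * xi y)); last first.
    by move=> y /eqP /invD ->.
  rewrite -mulr_sumr; apply: rpredM; first exact: rpred_nat.
  exact: char_sum_generators.
rewrite big_pred0 ?rpred0 // => y; apply/negP=> yC.
by case/existsP: noC; exists y.
Qed.

(** Second orthogonality: conjugacy classes of an abelian group are points. *)
Lemma fourier_inversion (f : gT -> algC) (x : gT) :
  abelian G ->
  \sum_(t : Iirr G) (\sum_y f y * 'chi_t y) * ('chi_t x)^* = #|gT|%:R * f x.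
Proof.
move=> abG.
under eq_bigr do rewrite mulr_suml; rewrite exchange_big /=.
rewrite (bigD1 x) //= [X in _ + X]big1 ?addr0 => [|y neq_yx].
  under eq_bigr do rewrite -mulrA; rewrite -mulr_sumr mulrC.
  rewrite second_orthogonality_relation ?inE // class_refl.
  rewrite (_ : (G :&: _)%g = G) ?cardsT //; apply/setIidPl.
  by rewrite sub_cent1 (subsetP abG) ?inE.
under eq_bigr do rewrite -mulrA; rewrite -mulr_sumr.
rewrite second_orthogonality_relation ?inE //.
suff /negPf-> : y \notin (x ^: G)%g by rewrite mulr0.
apply: contra neq_yx => /imsetP[z _ ->].
by rewrite conjgE (centsP abG x _ z) ?inE // mulKg.
Qed.

(** Galois descent: if y = x ^+ k with k prime to the order of x, some
    automorphism u of algC sends the values of the linear characters at x to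
    their values at y, and u fixes both D x and the integral Fourier
    coefficients of D. *)
Lemma invariant_of_char_sum_int (D : {ffun gT -> nat}) :
  abelian G ->
  (forall t : Iirr G, char_sum 'chi_t D \in Num.int) -> generator_invariant D.
Proof.
move=> abG intD x y /eqP xy.
have [k defy] : exists k, y = (x ^+ k)%g.
  by apply/cycleP; rewrite (eqP xy) cycle_id.
have co_k : coprime k #[x].
  by rewrite coprime_sym -generator_coprime -defy.
have [u uE] := Qn_aut_exists co_k.
have G_gt0 : #|gT|%:R != 0 :> algC.
  by rewrite pnatr_eq0 -cardsT -lt0n (cardG_gt0 G).
apply/eqP; rewrite -(eqr_nat algC) -(inj_eq (mulfI G_gt0)).
have inv z : #|gT|%:R * (D z)%:R =
    \sum_(t : Iirr G) char_sum 'chi_t D * ('chi_t z)^*.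
  by rewrite -(fourier_inversion (fun z => (D z)%:R)).
have -> : #|gT|%:R * (D x)%:R = u (#|gT|%:R * (D x)%:R).
  by rewrite rmorphM !rmorph_nat.
rewrite !inv rmorph_sum.
apply/eqP; apply: eq_bigr => t _; rewrite rmorphM; congr (_ * _).
  by rewrite aut_intr //; apply: intD.
have lin_t := char_abelianP _ abG t.
have unity : ('chi_t x^-1%g) ^+ #[x] = 1.
  by rewrite -lin_charX ?inE // expgVn expg_order invg1 lin_char1.
by rewrite -!irr_inv (uE _ unity) defy -expgVn lin_charX ?inE.
Qed.

Lemma integral_cone_char_sum (D : {ffun gT -> nat}) :
  abelian G ->
  integral_cone D <-> (forall t : Iirr G, char_sum 'chi_t D \in Num.int).
Proof.
move=> abG; split=> [/(integral_cone_invariant abG) invD t | intD].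
  by apply: char_sum_int => //; apply: irr_char.
by apply/integral_cone_invariant/invariant_of_char_sum_int.
Qed.

End CharacterSums.

(** * Cayley spectra and matrix representations *)

Section CayleySpectrum.

Variable gT : finGroupType.
Local Notation G := [set: gT].
Variable D : {ffun gT -> nat}.

Definition multiset_mx n (R : gT -> 'M[algC]_n) : 'M_n :=
  \sum_s (D s)%:R *: R s.

(** Row eigenvectors of the adjacency matrix, read as functions on the group:
    the sum over s is the sum over x = s * y. *)
Lemma cayley_eigenvalueP (a : algC) :
  eigenvalue (cayley_adjacency D) a <->
  exists2 f : gT -> algC, (exists x, f x != 0) &
    forall y, \sum_s (D s)%:R * f (s * y)%g = a * f y.
Proof.
have shift (f : gT -> algC) y :
    \sum_s (D s)%:R * f (s * y)%g = \sum_x f x * (D (x * y^-1)%g)%:R.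
  rewrite [RHS](reindex_inj (mulIg y)) /=.
  by apply: eq_bigr => s _; rewrite mulgK mulrC.
split=> [/eigenvalueP[v eig_v nz_v] | [f [x nz_fx] eig_f]].
  exists (fun x => v 0 (enum_rank x)) => [|y].
    have [r nz_vr] := rV0Pn _ nz_v.
    by exists (enum_val r); rewrite enum_valK.
  have := congr1 (fun w : 'rV_ _ => w 0 (enum_rank y)) eig_v.
  rewrite !mxE => <-; rewrite (shift (fun x => v 0 (enum_rank x))).
  rewrite (reindex _ (onW_bij _ (enum_val_bij gT))) /=.
  by apply: eq_bigr => r _; rewrite enum_valK mxE /cayley_edges enum_rankK.
apply/eigenvalueP; exists (\row_r f (enum_val r)); last first.
  by apply/rV0Pn; exists (enum_rank x); rewrite mxE enum_rankK.
apply/rowP=> r; rewrite !mxE -eig_f shift.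
rewrite [RHS](reindex _ (onW_bij _ (enum_val_bij gT))) /=.
by apply: eq_bigr => t _; rewrite !mxE.
Qed.

(** If v is an eigenvector in the representation space, any nonzero coordinate
    of x |-> v *m R x is an eigenfunction on the group. *)
Lemma eigenvalue_cayley_of_repr n (R : gT -> 'M[algC]_n) a :
  mx_repr G R -> eigenvalue (multiset_mx R) a ->
  eigenvalue (cayley_adjacency D) a.
Proof.
move=> [R1 RM] /eigenvalueP[v eig_v /rV0Pn[r nz_vr]].
apply/cayley_eigenvalueP; exists (fun x => (v *m R x) 0 r) => [|y /=].
  by exists 1%g; rewrite R1 mulmx1.
have -> : a * (v *m R y) 0 r = (v *m multiset_mx R *m R y) 0 r.
  by rewrite eig_v -scalemxAl [in RHS]mxE.
rewrite /multiset_mx mulmx_sumr mulmx_suml summxE.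
apply: eq_bigr => s _.
by rewrite RM ?inE // -scalemxAr -scalemxAl [in RHS]mxE mulmxA.
Qed.

(** The Fourier transform of an eigenfunction f turns the adjacency operator
    into right multiplication by [multiset_mx R], so each nonzero row of the
    transform is an eigenvector. The inverse in f y^-1 makes up for the shifts
    acting on the left of the argument of f. *)
Lemma eigenvalue_repr_of_cayley n (R : gT -> 'M[algC]_n) (f : gT -> algC) a :
  mx_repr G R ->
  (forall y, \sum_s (D s)%:R * f (s * y)%g = a * f y) ->
  \sum_y f y^-1%g *: R y != 0 -> eigenvalue (multiset_mx R) a.
Proof.
move=> [_ RM] eig_f; set F := \sum_y _ => nzF.
have eigF : F *m multiset_mx R = a *: F.
  rewrite /F mulmx_suml scaler_sumr.
  under eq_bigr do rewrite /multiset_mx mulmx_sumr.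
  transitivity (\sum_y \sum_s (f (s * y^-1)%g * (D s)%:R) *: R y).
    rewrite exchange_big [RHS]exchange_big; apply: eq_bigr => s _ /=.
    rewrite [RHS](reindex_inj (mulIg s)) /=; apply: eq_bigr => y _.
    by rewrite RM ?inE // invMg mulKVg -scalemxAl -scalemxAr scalerA.
  apply: eq_bigr => y _; rewrite scalerA -eig_f scaler_suml.
  by apply: eq_bigr => s _; rewrite mulrC.
have [r nz_r] : exists r, row r F != 0.
  apply/existsP; apply: contraR nzF; rewrite negb_exists => /forallP rows0.
  by apply/eqP/row_matrixP=> r; have := rows0 r; rewrite negbK row0 => /eqP.
by apply/eigenvalueP; exists (row r F); rewrite // -row_mul eigF linearZ.
Qed.

End CayleySpectrum.

Section ProductRepresentations.

Variables qT aT : finGroupType.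
Variable lambda : 'CF([set: aT]).
Hypothesis lin_lambda : lambda \is a linear_char.
Variables (n : nat) (Q : qT -> 'M[algC]_n).

Definition twisted_repr (p : qT * aT) : 'M[algC]_n := lambda p.2 *: Q p.1.

Lemma twisted_mx_repr :
  mx_repr [set: qT] Q -> mx_repr [set: qT * aT] twisted_repr.
Proof.
move=> [Q1 QM]; split; rewrite /twisted_repr /=.
  by rewrite lin_char1 // scale1r.
move=> p r _ _ /=; rewrite lin_charM ?inE // QM ?inE //.
by rewrite -scalemxAl -scalemxAr scalerA.
Qed.

Lemma sum_twisted (h : qT * aT -> algC) :
  \sum_p h p *: twisted_repr p = \sum_q (\sum_a h (q, a) * lambda a) *: Q q.
Proof.
under [RHS]eq_bigr do rewrite scaler_suml; rewrite pair_big /=.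
by apply: eq_bigr => -[q a] _ /=; rewrite scalerA.
Qed.

Lemma multiset_mx_twisted (S : {ffun qT * aT -> nat}) :
  multiset_mx S twisted_repr = \sum_q char_sum lambda (fiber S q) *: Q q.
Proof.
rewrite /multiset_mx sum_twisted; apply: eq_bigr => q _; congr (_ *: _).
by apply: eq_bigr => a _; rewrite ffunE.
Qed.

End ProductRepresentations.

Lemma eigenvalue_scalar1 (F : fieldType) (a b : F) :
  eigenvalue (b%:M : 'M_1) a = (a == b).
Proof.
apply/eigenvalueP/eqP=> [[v] | ->].
  rewrite mul_mx_scalar => /eqP; rewrite -subr_eq0 -scalerBl scaler_eq0.
  by case/orP=> [/eqP/subr0_eq-> // | ->].
by exists 1%:M; rewrite ?mul_mx_scalar // oner_eq0.
Qed.

(** * Two by two matrices *)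

Section Matrix2.

Variable F : fieldType.
Implicit Types a b c d e f g h : F.

Definition mx2 a b c d : 'M[F]_2 :=
  \matrix_(r, s) if r == 0 then (if s == 0 then a else b)
                 else (if s == 0 then c else d).

Lemma mx2P (M N : 'M[F]_2) :
  M 0 0 = N 0 0 -> M 0 1 = N 0 1 -> M 1 0 = N 1 0 -> M 1 1 = N 1 1 -> M = N.
Proof.
move=> e00 e01 e10 e11; apply/matrixP=> r s.
have ord2 (t : 'I_2) : t = 0 \/ t = 1.
  by case: t => -[|[|//]] lt; [left | right]; apply: val_inj.
by have [->|->] := ord2 r; have [->|->] := ord2 s.
Qed.

Lemma mx2M a b c d e f g h :
  mx2 a b c d *m mx2 e f g h =
  mx2 (a * e + b * g) (a * f + b * h) (c * e + d * g) (c * f + d * h).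
Proof. by apply: mx2P; rewrite !mxE !big_ord_recl big_ord0 !mxE /= addr0. Qed.

Lemma mx2D a b c d e f g h :
  mx2 a b c d + mx2 e f g h = mx2 (a + e) (b + f) (c + g) (d + h).
Proof. by apply: mx2P; rewrite !mxE. Qed.

Lemma mx2N a b c d : - mx2 a b c d = mx2 (- a) (- b) (- c) (- d).
Proof. by apply: mx2P; rewrite !mxE. Qed.

Lemma mx2Z x a b c d : x *: mx2 a b c d = mx2 (x * a) (x * b) (x * c) (x * d).
Proof. by apply: mx2P; rewrite !mxE. Qed.

Lemma mx2_scalar a : a%:M = mx2 a 0 0 a.
Proof. by apply: mx2P; rewrite !mxE. Qed.

Lemma mx2_1 : 1 = mx2 1 0 0 1.
Proof. exact: mx2_scalar. Qed.

Lemma eigenvalue_mx2 a b c d x :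
  eigenvalue (mx2 a b c d) x = ((x - a) * (x - d) - b * c == 0).
Proof.
rewrite /eigenvalue kermx_eq0 row_free_unit unitmxE unitfE negbK.
rewrite (expand_det_row _ 0) !big_ord_recl big_ord0 /cofactor !det_mx11.
rewrite !mxE /= !mulr1n !mulr0n; congr (_ == 0); ring.
Qed.

End Matrix2.

(** * Representations of the quaternion group *)

(** The value, at the character of the Klein four-group Q_8 / {1, -1} that maps
    i to (-1) ^+ e and j to (-1) ^+ e', of the element of its group algebra with
    coefficients a, b, c, d on the classes of 1, i, j, k. *)
Definition signed_sum (a b c d : algC) (e e' : bool) : algC :=
  a + (-1) ^+ e * b + (-1) ^+ e' * c + (-1) ^+ e * (-1) ^+ e' * d.

(** Fourier inversion on the Klein four-group. *)
Lemma signed_sum_inv a b c d :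
  let F := signed_sum a b c d in
  [/\ 4 * a = F false false + F false true + F true false + F true true,
      4 * b = F false false + F false true - F true false - F true true,
      4 * c = F false false - F false true + F true false - F true true &
      4 * d = F false false - F false true - F true false + F true true].
Proof. by rewrite /signed_sum /=; split; ring. Qed.

Section QuaternionRepresentations.

Variables m1 i j k : gsort 'Q_8.
Hypothesis quat : quaternion_units m1 i j k.

Local Notation units := [:: 1; m1; i; m1 * i; j; m1 * j; k; m1 * k]%g.

Lemma quaternion_ind (P : gsort 'Q_8 -> Prop) :
  P 1%g -> P m1 -> P i -> P (m1 * i)%g -> P j -> P (m1 * j)%g ->
  P k -> P (m1 * k)%g -> forall q, P q.
Proof.
move=> P1 Pm Pi Pmi Pj Pmj Pk Pmk q.
have [_ /(_ q)] := quaternion_units_enum quat.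
by rewrite !inE; do 7?[case/orP=> [/eqP-> //|]] => /eqP->.
Qed.

Lemma quaternion_sum (V : zmodType) (f : gsort 'Q_8 -> V) :
  \sum_q f q = (f 1%g + f m1) + (f i + f (m1 * i)%g) +
               (f j + f (m1 * j)%g) + (f k + f (m1 * k)%g).
Proof.
have [us memE] := quaternion_units_enum quat.
have -> : \sum_q f q = \sum_(q <- units) f q.
  by rewrite [RHS]big_uniq //; apply: eq_bigl => q; rewrite memE inE.
by rewrite !big_cons big_nil addr0 !addrA.
Qed.

Lemma quaternion_mul :
  [/\ (i * i = m1)%g, (j * j = m1)%g, (m1 * m1 = 1)%g, (i * j = k)%g &
      (j * i = m1 * k)%g].
Proof.
have [_ [i2 j2 k2 ijk]] := quat.
have kE : (k = i * j)%g by apply: (mulIg k); rewrite ijk -k2 expgS expg1.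
have ii : (i * i = m1)%g by rewrite -i2 expgS expg1.
have jj : (j * j = m1)%g by rewrite -j2 expgS expg1.
have kk : (k * k = m1)%g by rewrite -k2 expgS expg1.
have jij : (j * i * j = i)%g by apply: (mulgI i); rewrite ii -kk kE !mulgA.
have mi : (m1 * i = i * m1)%g by rewrite -ii mulgA.
have mj : (m1 * j = j * m1)%g by rewrite -jj mulgA.
(* Squaring j * i * j = i gives m1 ^+ 3 = m1. *)
have mm : (m1 * m1 = 1)%g.
  have cube : (j * i * j * (j * i * j) = m1 * m1 * m1)%g.
    rewrite !mulgA -(mulgA _ j j) jj -(mulgA j i m1) -mi !mulgA -mj.
    by rewrite -(mulgA _ i i) ii -(mulgA m1 j m1) -mj !mulgA -(mulgA _ j j) jj.
  by apply: (mulIg m1); rewrite -cube jij ii mul1g.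
split=> //; apply: (mulIg j).
by rewrite jij kE -!mulgA jj -mi mulgA mm mul1g.
Qed.

Section Hom.

Variables (B : nzRingType) (z x y : B).
Hypotheses (zz : z * z = 1) (xx : x * x = z) (yy : y * y = z).
Hypothesis yx : y * x = z * (x * y).

(** The extension of -1 |-> z, i |-> x, j |-> y to Q_8, as a table: a ring
    element with the relations of i need not live in a finite group, so the
    presentation of Q_8 as a finite group does not produce this map. *)
Definition quaternion_hom (q : gsort 'Q_8) : B :=
  nth 0 [:: 1; z; x; z * x; y; z * y; x * y; z * (x * y)] (index q units).

Lemma quaternion_homE :
  [/\ [/\ quaternion_hom 1%g = 1, quaternion_hom m1 = z,
        quaternion_hom i = x & quaternion_hom (m1 * i)%g = z * x],
      quaternion_hom j = y /\ quaternion_hom (m1 * j)%g = z * y,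
      quaternion_hom k = x * y & quaternion_hom (m1 * k)%g = z * (x * y)].
Proof.
have [us _] := quaternion_units_enum quat.
have val t : (t < 8)%N -> quaternion_hom (nth 1%g units t) =
    nth 0 [:: 1; z; x; z * x; y; z * y; x * y; z * (x * y)] t.
  by move=> lt8; rewrite /quaternion_hom index_uniq.
by do !split; [apply: (val 0%N) | apply: (val 1%N) | apply: (val 2%N)
  | apply: (val 3%N) | apply: (val 4%N) | apply: (val 5%N) | apply: (val 6%N)
  | apply: (val 7%N)].
Qed.

(** The elements g such that left multiplication by g is respected are closed
    under products, so only g = i and g = j need the multiplication table. *)
Lemma quaternion_homM p q :
  quaternion_hom (p * q)%g = quaternion_hom p * quaternion_hom q.
Proof.
have [ii jj mm ij ji] := quaternion_mul.
have [[h1 hm hi hmi] [hj hmj] hk hmk] := quaternion_homE.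
have mi : (i * m1 = m1 * i)%g by rewrite -ii mulgA.
have mj : (j * m1 = m1 * j)%g by rewrite -jj mulgA.
have mK q' : (m1 * (m1 * q') = q')%g by rewrite mulgA mm mul1g.
have ik : (i * k = m1 * j)%g by rewrite -ij mulgA ii.
have jk : (j * k = i)%g.
  by rewrite -ij mulgA ji -ij -!mulgA jj mi mK.
have zx : x * z = z * x by rewrite -xx mulrA.
have zy : y * z = z * y by rewrite -yy mulrA.
have zK b : z * (z * b) = b by rewrite mulrA zz mul1r.
have xz b : x * (z * b) = z * (x * b) by rewrite !mulrA zx.
have yz b : y * (z * b) = z * (y * b) by rewrite !mulrA zy.
pose good g := forall q',
  quaternion_hom (g * q')%g = quaternion_hom g * quaternion_hom q'.
have goodM g h : good g -> good h -> good (g * h)%g.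
  by move=> gg gh r; rewrite -mulgA [LHS]gg gh [in RHS]gg mulrA.
have good_i : good i.
  apply: quaternion_ind; rewrite hi ?(mulgA i m1) ?mi -?(mulgA m1 i).
  - by rewrite mulg1 h1 mulr1.
  - by rewrite hmi hm zx.
  - by rewrite ii hm xx.
  - by rewrite ii mm h1 hmi xz xx zz.
  - by rewrite ij hk hj.
  - by rewrite ij hmk hmj xz.
  - by rewrite ik hmj hk mulrA xx.
  - by rewrite ik mK hj hmk xz (mulrA x x) xx zK.
have good_j : good j.
  apply: quaternion_ind; rewrite hj ?(mulgA j m1) ?mj -?(mulgA m1 j).
  - by rewrite mulg1 h1 mulr1.
  - by rewrite hmj hm zy.
  - by rewrite ji hmk hi yx.
  - by rewrite ji mK hk hmi yz yx zK.
  - by rewrite jj hm yy.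
  - by rewrite jj mm h1 hmj yz yy zz.
  - by rewrite jk hi hk mulrA yx -!mulrA yy zx zK.
  - by rewrite jk hmi hmk yz (mulrA y x) yx -!mulrA yy zx zK.
suff good_all g : good g by apply: good_all.
have good_m : good m1 by rewrite -ii; apply: goodM.
have good_k : good k by rewrite -ij; apply: goodM.
elim/quaternion_ind: g; rewrite ?{1}/good //; try exact: goodM.
by move=> r; rewrite mul1g h1 mul1r.
Qed.

End Hom.

Definition quaternion_lin (e d : bool) : gsort 'Q_8 -> 'M[algC]_1 :=
  fun q => (quaternion_hom 1 ((-1) ^+ e) ((-1) ^+ d) q)%:M.

Lemma quaternion_lin_repr e d : mx_repr [set: gsort 'Q_8] (quaternion_lin e d).
Proof.
have sq (b : bool) : (-1) ^+ b * (-1) ^+ b = 1 :> algC.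
  by rewrite -signr_addb addbb.
have [[h1 _ _ _] _ _ _] := quaternion_homE 1 ((-1) ^+ e) ((-1) ^+ d : algC).
split=> [|p q _ _]; rewrite /quaternion_lin ?h1 //.
by rewrite (quaternion_homM (mul1r 1) (sq e) (sq d)) ?scalar_mxM // mul1r mulrC.
Qed.

Lemma quaternion_lin_sum e d (f : gsort 'Q_8 -> algC) :
  \sum_q f q *: quaternion_lin e d q =
  (signed_sum (f 1%g + f m1) (f i + f (m1 * i)%g) (f j + f (m1 * j)%g)
              (f k + f (m1 * k)%g) e d)%:M.
Proof.
have [[h1 hm hi hmi] [hj hmj] hk hmk] :=
  quaternion_homE 1 ((-1) ^+ e) ((-1) ^+ d : algC).
rewrite quaternion_sum /quaternion_lin h1 hm hi hmi hj hmj hk hmk !mul1r.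
by rewrite !scale_scalar_mx -!raddfD /=; congr _%:M; rewrite /signed_sum; ring.
Qed.

(** The irreducible representation of degree 2, by the Pauli matrices up to
    factors of 'i. *)
Definition quaternion_spin : gsort 'Q_8 -> 'M[algC]_2 :=
  quaternion_hom (- 1) (mx2 'i 0 0 (- 'i)) (mx2 0 1 (-1) 0).

Lemma quaternion_spin_repr : mx_repr [set: gsort 'Q_8] quaternion_spin.
Proof.
have ii : 'i * 'i = -1 :> algC by rewrite -expr2 sqrCi.
set x := mx2 'i 0 0 (- 'i) : 'M[algC]_2; set y := mx2 0 1 (-1) 0 : 'M[algC]_2.
have N1 : -1 = mx2 (-1) 0 0 (-1) :> 'M[algC]_2.
  by rewrite mx2_1 mx2N !oppr0.
have xx : x * x = -1.
  by rewrite N1 -mulmxE mx2M mulrNN ii !(mulr0, mul0r, addr0, add0r).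
have yy : y * y = -1.
  by rewrite N1 -mulmxE mx2M !(mulr0, mul0r, addr0, add0r, mulr1, mul1r).
have yx : y * x = -1 * (x * y).
  rewrite mulN1r -!mulmxE !mx2M mx2N; congr mx2; ring.
have [[h1 _ _ _] _ _ _] := quaternion_homE (-1) x y.
split=> [|p q _ _]; rewrite /quaternion_spin ?h1 //.
by rewrite (quaternion_homM _ xx yy yx) // mulrNN mulr1.
Qed.

Lemma quaternion_spin_sum (f : gsort 'Q_8 -> algC) :
  let d q := f q - f (m1 * q)%g in
  \sum_q f q *: quaternion_spin q =
  mx2 (d 1%g + 'i * d i) (d j + 'i * d k) ('i * d k - d j) (d 1%g - 'i * d i).
Proof.
move=> d.
have [[h1 hm hi hmi] [hj hmj] hk hmk] :=
  quaternion_homE (-1) (mx2 'i 0 0 (- 'i)) (mx2 0 1 (-1) 0 : 'M[algC]_2).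
rewrite quaternion_sum /quaternion_spin h1 hm hi hmi hj hmj hk hmk !mulN1r.
rewrite -mulmxE mx2M mx2_1 !mx2N !mx2Z !mx2D /d mulg1; congr mx2; ring.
Qed.

(** The five representations have degrees of squared sum 1 + 1 + 1 + 1 + 4 = 8:
    the linear ones determine the sums f u + f (- u), and the spin one the
    differences f u - f (- u). *)
Lemma quaternion_repr_complete (f : gsort 'Q_8 -> algC) q :
  (forall e d, \sum_q f q *: quaternion_lin e d q = 0) ->
  \sum_q f q *: quaternion_spin q = 0 -> f q = 0.
Proof.
move=> lin0 spin0.
pose s u := f u + f (m1 * u)%g; pose d u := f u - f (m1 * u)%g.
have [ii jj mm _ _] := quaternion_mul.
have lin e e' : signed_sum (s 1%g) (s i) (s j) (s k) e e' = 0.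
  have := lin0 e e'; rewrite quaternion_lin_sum => /matrixP/(_ 0 0).
  by rewrite !mxE mulr1n /s mulg1.
have cancel2 (a b : algC) : a + b = 0 -> a - b = 0 -> a = 0 /\ b = 0.
  move=> ab0 amb0; have b_a : b = - a by apply/eqP; rewrite -addr_eq0 addrC ab0.
  have : 2 * a = 0 by rewrite -amb0 b_a; ring.
  by move/eqP; rewrite b_a mulf_eq0 pnatr_eq0 /= => /eqP->; rewrite oppr0.
have quarter (a : algC) : 4 * a = 0 -> a = 0.
  by move/eqP; rewrite mulf_eq0 pnatr_eq0 /= => /eqP.
have [s1 si sj sk] := signed_sum_inv (s 1%g) (s i) (s j) (s k).
rewrite !lin !(addr0, subr0) in s1 si sj sk.
have := spin0; rewrite quaternion_spin_sum -!/(d _) => /matrixP spin.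
have := (spin 0 0, spin 1 1, spin 0 1, spin 1 0).
(* The diagonal entries are d 1 +- 'i * d i, the others 'i * d k +- d j. *)
rewrite !mxE /= => -[[[e00 e11] e01] e10].
have [d1 di] := cancel2 _ _ e00 e11.
have [dk dj] : 'i * d k = 0 /\ d j = 0 by apply: cancel2; rewrite // addrC.
have i_cancel (a : algC) : 'i * a = 0 -> a = 0.
  by move/eqP; rewrite mulf_eq0 (negPf (neq0Ci _)) => /eqP.
have pair u : s u = 0 -> d u = 0 -> f u = 0 /\ f (m1 * u)%g = 0.
  exact: cancel2.
have [f1 fm] := pair _ (quarter _ s1) d1.
have [fi fmi] := pair _ (quarter _ si) (i_cancel _ di).
have [fj fmj] := pair _ (quarter _ sj) dj.
have [fk fmk] := pair _ (quarter _ sk) (i_cancel _ dk).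
by rewrite mulg1 in fm; move: q; apply: quaternion_ind.
Qed.

End QuaternionRepresentations.

(** * Cayley multigraphs on the product of Q_8 and an abelian group *)

Section QuaternionCayley.

Variables (aT : finGroupType) (m1 i j k : gsort 'Q_8).
Variable S : {ffun gsort 'Q_8 * aT -> nat}.
Hypotheses (abelA : abelian [set: aT]) (quat : quaternion_units m1 i j k).

Local Notation c t u := (char_sum 'chi[[set: aT]]_t (fiber S u)).
Local Notation s t u := (c t u + c t (m1 * u)%g).
Local Notation d t u := (c t u - c t (m1 * u)%g).

Lemma multiset_mx_lin t e e' :
  multiset_mx S (twisted_repr 'chi_t (quaternion_lin m1 i j k e e')) =
  (signed_sum (s t 1%g) (s t i) (s t j) (s t k) e e')%:M.
Proof.
by rewrite multiset_mx_twisted (quaternion_lin_sum quat) mulg1.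
Qed.

Lemma eigenvalue_spin t a :
  eigenvalue (multiset_mx S (twisted_repr 'chi_t (quaternion_spin m1 i j k))) a =
  ((a - d t 1%g) ^+ 2 == - (d t i ^+ 2 + d t j ^+ 2 + d t k ^+ 2)).
Proof.
rewrite multiset_mx_twisted (quaternion_spin_sum quat) eigenvalue_mx2 -addr_eq0.
have ii : 'i ^+ 2 = -1 :> algC := sqrCi _.
congr (_ == 0); ring: ii.
Qed.

(** An eigenfunction on the product has a nonzero Fourier transform at some
    character of A, by Fourier inversion on A, and then at one of the five
    representations of Q_8. *)
Lemma cayley_integral_quaternion :
  cayley_integral S <->
  forall t : Iirr [set: aT],
    (forall e e', signed_sum (s t 1%g) (s t i) (s t j) (s t k) e e'
                    \in Num.int) /\
    (forall a, (a - d t 1%g) ^+ 2 = - (d t i ^+ 2 + d t j ^+ 2 + d t k ^+ 2) ->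
       a \in Num.int).
Proof.
have lin t := char_abelianP _ abelA t.
split=> [intS t | int_t a /cayley_eigenvalueP[f [x nz_fx] eig_f]].
  split=> [e e' | a def_a]; apply: intS.
    apply: (eigenvalue_cayley_of_repr
      (twisted_mx_repr (lin t) (quaternion_lin_repr quat e e'))).
    by rewrite multiset_mx_lin eigenvalue_scalar1.
  apply: (eigenvalue_cayley_of_repr
    (twisted_mx_repr (lin t) (quaternion_spin_repr quat))).
  by rewrite eigenvalue_spin; apply/eqP.
pose h p := f p^-1%g; case defx: (x^-1%g) => [q b].
pose H t u := \sum_b h (u, b) * 'chi[[set: aT]]_t b.
have [t nzH] : exists t, H t q != 0.
  apply/existsP; apply: contraR nz_fx; rewrite negb_exists => /forallP H0.
  have := fourier_inversion (fun b => h (q, b)) b abelA.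
  rewrite big1 => [/esym/eqP|t _]; last first.
    by have /negPn/eqP := H0 t; rewrite /H => ->; rewrite mul0r.
  by rewrite /h -defx invgK mulf_eq0 -cardsT (negPf (neq0CG _)).
have [intL intP] := int_t t.
have [/existsP[e /existsP[e' nzL]] | noL] := boolP [exists e, exists e',
    \sum_u H t u *: quaternion_lin m1 i j k e e' u != 0].
  have := eigenvalue_repr_of_cayley
    (twisted_mx_repr (lin t) (quaternion_lin_repr quat e e')) eig_f.
  rewrite (sum_twisted _ _ h) => /(_ nzL).
  by rewrite multiset_mx_lin eigenvalue_scalar1 => /eqP->.
apply: intP; apply/eqP; rewrite -eigenvalue_spin.
apply: (eigenvalue_repr_of_cayley
  (twisted_mx_repr (lin t) (quaternion_spin_repr quat)) eig_f).
rewrite (sum_twisted _ _ h); apply: contra nzH => /eqP spin0; apply/eqP.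
apply: (quaternion_repr_complete quat) spin0 => e e'.
apply/eqP; apply: contraR noL => nz.
by apply/existsP; exists e; apply/existsP; exists e'.
Qed.

Lemma char_hat_fiber (xi : 'CF([set: aT])) u :
  inverse_closed S -> (u * u = m1)%g ->
  char_hat xi (fiber S u) =
  char_sum xi (fiber S u) - char_sum xi (fiber S (m1 * u)%g).
Proof.
have [_ _ mm _ _] := quaternion_mul quat.
move=> invS uu; congr (_ - char_sum _ _); apply/ffunP=> a; rewrite !ffunE invS.
congr (S (_, _)); last exact: invgK.
by apply: (mulIg u); rewrite mulVg -mulgA uu mm.
Qed.

End QuaternionCayley.

(** * Arithmetic of character sums *)

Lemma char_sum_Aint (gT : finGroupType) (t : Iirr [set: gT]) D :
  char_sum 'chi_t D \in Aint.
Proof.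
by apply: rpred_sum => g _; rewrite rpredM ?Aint_irr ?rpred_nat.
Qed.

Lemma char_sumU (gT : finGroupType) (xi : 'CF([set: gT])) D E :
  char_sum xi (multiset_union D E) = char_sum xi D + char_sum xi E.
Proof.
rewrite -big_split; apply: eq_bigr => g _ /=.
by rewrite ffunE natrD mulrDl.
Qed.

Lemma int_of_mulrn n (a : algC) :
  a \in Aint -> n.+1%:R * a \in Num.int -> a \in Num.int.
Proof.
move=> Aint_a int_na; apply: Cint_rat_Aint => //.
have -> : a = n.+1%:R * a / n.+1%:R by rewrite mulrC mulKf ?pnatr_eq0.
by have [z ->] := intrP int_na; rewrite rpred_div ?rpred_int ?rpred_nat.
Qed.

Lemma signed_sum_int (a b c d : algC) :
  a \in Aint -> b \in Aint -> c \in Aint -> d \in Aint ->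
  (forall e e', signed_sum a b c d e e' \in Num.int) ->
  [/\ a \in Num.int, b \in Num.int, c \in Num.int & d \in Num.int].
Proof.
move=> Aa Ab Ac Ad; have [ea eb ec ed] := signed_sum_inv a b c d.
(* Abstracting the sum keeps the closure lemmas from splitting its terms. *)
move: (signed_sum a b c d) ea eb ec ed => F ea eb ec ed intF.
by split; apply: (@int_of_mulrn 3) => //;
  rewrite ?(ea, eb, ec, ed) ?(rpredB, rpredD) ?intF.
Qed.

(** * Integral Cayley multigraphs *)

Theorem theorem11 (aT : finGroupType) (m1 i j k : gsort 'Q_8)
    (S : {ffun gsort 'Q_8 * aT -> nat}) :
  abelian [set: aT] ->
  quaternion_units m1 i j k ->
  inverse_closed S ->
  cayley_integral S <->
    [/\ integral_cone (fiber S 1%g) /\ integral_cone (fiber S m1),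
        forall q : gsort 'Q_8, q != 1%g -> q != m1 ->
          integral_cone (multiset_union (fiber S q) (fiber S (m1 * q)%g))
      & forall lambda : 'CF([set: aT]), lambda \in irr [set: aT] ->
          exists m : int,
            (char_hat lambda (fiber S i) ^+ 2 +
             char_hat lambda (fiber S j) ^+ 2 +
             char_hat lambda (fiber S k) ^+ 2 = - (m%:~R ^+ 2))%R].
Proof.
move=> abelA quat invS; rewrite (cayley_integral_quaternion S abelA quat).
have [ii jj mm _ _] := quaternion_mul quat.
have kk : (k * k = m1)%g by have [_ [_ _ <- _]] := quat; rewrite expgS expg1.
have hat u (t : Iirr [set: aT]) := char_hat_fiber quat 'chi_t (u := u) invS.
have cone D := integral_cone_char_sum D abelA.
split=> [spec | [[cone1 conem] coneU neg_square] t].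
  pose c (t : Iirr [set: aT]) u := char_sum 'chi_t (fiber S u).
  have Ac t u : c t u \in Aint by apply: char_sum_Aint.
  have int_s t : [/\ c t 1%g + c t m1 \in Num.int,
      c t i + c t (m1 * i)%g \in Num.int, c t j + c t (m1 * j)%g \in Num.int
      & c t k + c t (m1 * k)%g \in Num.int].
    have [lin _] := spec t; rewrite mulg1 in lin.
    by apply: signed_sum_int; rewrite ?rpredD ?Ac.
  (* The spin eigenvalues are d_1 + r and d_1 - r, so r is the integer whose
     existence is the third condition. *)
  pose r t := sqrtC (- (char_hat 'chi[[set: aT]]_t (fiber S i) ^+ 2 +
    char_hat 'chi[[set: aT]]_t (fiber S j) ^+ 2 +
    char_hat 'chi[[set: aT]]_t (fiber S k) ^+ 2)).
  have int_r t : c t 1%g - c t m1 + r t \in Num.int /\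
                 c t 1%g - c t m1 - r t \in Num.int.
    have [_ spin] := spec t; rewrite mulg1 -!hat // in spin.
    by split; apply: spin; rewrite addrC addKr ?sqrrN sqrtCK.
  have int_1m t : c t 1%g \in Num.int /\ c t m1 \in Num.int.
    have [int_s1 _ _ _] := int_s t; have [rp rm] := int_r t.
    (* Twice the linear sum c_1 + c_{-1} plus the trace 2 (c_1 - c_{-1}) of the
       spin matrix is 4 c_1. *)
    have int_c1 : c t 1%g \in Num.int.
      apply: (@int_of_mulrn 3) => //.
      have -> : 4 * c t 1%g = 2 * (c t 1%g + c t m1) +
         ((c t 1%g - c t m1 + r t) + (c t 1%g - c t m1 - r t)) by ring.
      by rewrite rpredD ?rpredM ?natr_int // rpredD.
    by split=> //; rewrite -(rpredDl _ int_c1).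
  split.
  - by split; apply/cone => t; have [] := int_1m t.
  - move=> q q1 qm; apply/cone=> t; rewrite char_sumU -!/(c _ _).
    have [_ si sj sk] := int_s t; move: q q1 qm.
    by apply: (quaternion_ind quat); rewrite ?eqxx // => _ _;
      rewrite ?mulgA ?mm ?mul1g // addrC.
  move=> _ /irrP[t ->]; have [c1 cm] := int_1m t; have [rp _] := int_r t.
  have /intrP[m def_m] : r t \in Num.int.
    by rewrite -(rpredDl _ (rpredB c1 cm)).
  by exists m; rewrite -def_m sqrtCK opprK.
have c1 := proj1 (cone _) cone1 t; have cm := proj1 (cone _) conem t.
(* Elements of square -1 differ from 1 and -1, as the second condition asks. *)
have nu u : (u * u = m1)%g -> (u != 1%g) && (u != m1).
  have [m1n1 _] := quat => uu; apply/andP; split; apply: contra m1n1 => /eqP du.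
    by rewrite -uu du mulg1.
  by rewrite -uu du mm.
have su u : (u * u = m1)%g ->
    char_sum 'chi_t (fiber S u) + char_sum 'chi_t (fiber S (m1 * u)%g)
      \in Num.int.
  move=> /nu/andP[u1 um]; rewrite -char_sumU.
  by apply: (proj1 (cone _)); apply: coneU.
set d1 := char_sum 'chi_t (fiber S 1%g) - char_sum 'chi_t (fiber S m1).
have int_d1 : d1 \in Num.int by rewrite rpredB.
rewrite mulg1 -/d1; split=> [e e' | a].
  rewrite /signed_sum -signr_addb !rpredD ?rpredMsign ?su //.
have [m] := neg_square 'chi_t (mem_irr t); rewrite !hat // => ->.
rewrite opprK => /eqP; rewrite eqf_sqr => /orP[] /eqP def_a.
  by rewrite -(subrK d1 a) def_a rpredD ?intr_int.
by rewrite -(subrK d1 a) def_a rpredD ?rpredN ?intr_int.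
Qed.
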